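(* Let $(X,\kappa)=(Y,\kappa) \vee (S,\kappa)$ (the wedge of $(Y,\kappa)$ and $(S,\kappa)$), where $Y$ is finite and $\#Y > 1$, $(Y,\kappa)$ is rigid, and $(S,\kappa)$ is a digital simple closed curve of at least $5$ points. Then $(X,\kappa)$ is rigid.
   Context: A digital image is a pair $(X,\kappa)$ where $X \subset \mathbb{Z}^n$ for some $n \in \mathbb{N}$ and $\kappa$ is an adjacency relation (a symmetric, irreflexive binary relation) on $X$; thus it is a simple graph. Write $x \leftrightarrow_\kappa y$ if $x,y$ are $\kappa$-adjacent. $\#X$ denotes the number of points of $X$. A function $f:(X,\kappa)\to(Y,\lambda)$ is $(\kappa,\lambda)$-continuous if $x \leftrightarrow_\kappa x'$ implies $f(x)=f(x')$ or $f(x)\leftrightarrow_\lambda f(x')$. Homotopy: For integers $a\le b$, $[a,b]_{\mathbb{Z}}=\{z\in\mathbb{Z} : a\le z\le b\}$, where $z,z'$ are adjacent iff $|z-z'|=1$. Continuous functions $f,g:(X,\kappa)\to(Y,\lambda)$ are homotopic if there are a positive integer $m$ and $F:X\times[0,m]_{\mathbb{Z}}\to Y$ such that $F(x,0)=f(x)$ and $F(x,m)=g(x)$ for all $x\in X$; for each $x\in X$ the map $t\mapsto F(x,t)$ is continuous (i.e., $F(x,t)$ and $F(x,t+1)$ are equal or adjacent for $0\le t<m$); and for each $t$ the map $x\mapsto F(x,t)$ is $(\kappa,\lambda)$-continuous. A digital image $X$ is rigid if the only map $X\to X$ homotopic to $\mathrm{id}_X$ is $\mathrm{id}_X$. Digital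 simple closed curve: a set $S=\{s_i\}_{i=0}^{m-1}$ of $m$ distinct points such that, for each $0\le i<m$, the only members of $S$ that are $\kappa$-adjacent to $s_i$ are $s_{(i-1)\bmod m}$ and $s_{(i+1)\bmod m}$ (and these are adjacent to $s_i$). Wedge: let $Y\cup S\subset \mathbb{Z}^n$ with adjacency $\kappa$ be such that $Y\cap S=\{x_0\}$ for some point $x_0 \in \mathbb{Z}^n$, and suppose that whenever $y\in Y$, $s\in S$ and ($y=s$ or $y\leftrightarrow_\kappa s$), we have $x_0\in\{y,s\}$. Then $X=Y\cup S$ (with adjacency $\kappa$) is called the wedge of $Y$ and $S$, denoted $Y\vee S$, and $x_0$ is the wedge point.
   Formalization: The formal theorem additionally assumes that some point of Y is adjacent to the wedge point x_0 (automatic if Y is connected, as #Y > 1); if x_0 is isolated in Y, rotating S by one step shows that X is not rigid, so the statement fails without it. *)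

(* Defs.v *)
From mathcomp Require Export all_boot all_order all_algebra.
From mathcomp Require Export finmap.
From mathcomp Require Export boolp classical_sets functions cardinality.

Set Implicit Arguments.
Unset Strict Implicit.
Unset Printing Implicit Defensive.

Import Order.TTheory GRing.Theory Num.Theory.

Local Open Scope classical_set_scope.
Local Open Scope ring_scope.

(* Images are subsets of an ambient type (Z^n is 'rV[int]_n). Adjacencies and
   maps are total on that type, and only their restriction to the image ever
   matters. *)

Definition digital_image (T : Type) (X : set T) (k : rel T) : Prop :=
  (forall x y, X x -> X y -> k x y -> k y x) /\ (forall x, X x -> ~~ k x x).

Definition digital_continuous (T U : Type) (X : set T) (k : rel T)
    (Y : set U) (l : rel U) (f : T -> U) : Prop :=
  set_fun X Y f /\
  (forall x x', X x -> X x' -> k x x' -> f x = f x' \/ l (f x) (f x')).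

Definition interval_Z (a b : int) : set int := [set z | a <= z <= b].

Definition adj_Z : rel int := fun z z' => `|z - z'| == 1.

Definition homotopic (T U : Type) (X : set T) (k : rel T)
    (Y : set U) (l : rel U) (f g : T -> U) : Prop :=
  [/\ digital_continuous X k Y l f,
      digital_continuous X k Y l g &
      exists (m : int) (F : T -> int -> U),
        [/\ 0 < m,
            forall x, X x -> F x 0 = f x /\ F x m = g x,
            forall x, X x ->
              digital_continuous (interval_Z 0 m) adj_Z Y l (F x) &
            forall t, interval_Z 0 m t ->
              digital_continuous X k Y l (fun x => F x t)]].

Definition rigid (T : Type) (X : set T) (k : rel T) : Prop :=
  forall f : T -> T, homotopic X k X k f id -> forall x, X x -> f x = x.

(* [ord_pred] and [ordS] are the predecessor and successor modulo m. *)
Definition simple_closed_curve (T : Type) (S : set T) (k : rel T) (m : nat) :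
    Prop :=
  exists s : 'I_m -> T,
    [/\ injective s,
        S = range s &
        forall i x, S x ->
          (k (s i) x <-> x = s (ord_pred i) \/ x = s (ordS i))].

Definition is_wedge (T : Type) (X Y S : set T) (k : rel T) (x0 : T) : Prop :=
  [/\ X = Y `|` S,
      Y `&` S = [set x0] &
      forall y s, Y y -> S s -> (y = s \/ k y s) -> x0 = y \/ x0 = s].

(* Main.v *)
(** It suffices to show that a continuous self-map g of X moving every point
    by at most one step is the identity, since a homotopy can then be walked
    back from the identity one time step at a time. Collapsing S to x0 turns g
    into a self-map of Y one step from the identity, so rigidity of Y makes g
    fix Y except possibly x0, and a neighbour of x0 in Y pins x0 as well.
    Collapsing Y instead, g displaces the i-th point of the cycle by
    e_i in {-1, 0, 1}; as the cycle has at least 5 points, continuity forces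
    e_(i+1) <= e_i, and e vanishes at x0, so going around the cycle e = 0. *)
Require Import Defs.
From mathcomp Require Import zify.

Set Implicit Arguments.
Unset Strict Implicit.

Local Open Scope classical_set_scope.
Local Open Scope fset_scope.
Local Open Scope ring_scope.

Lemma is_wedge_sym (T : Type) (X Y S : set T) (k : rel T) (x0 : T) :
  digital_image X k -> is_wedge X Y S k x0 -> is_wedge X S Y k x0.
Proof.
move=> [ksym _] [XE YS W]; split; first by rewrite XE setUC.
  by rewrite setIC.
move=> s y Ss Yy sy; apply/or_comm/W => //.
case: sy => [->|sy]; [by left | right; apply: ksym => //; rewrite XE].
  by right.
by left.
Qed.

Definition collapse (T : Type) (A : set T) (x0 x : T) : T :=
  if `[< A x >] then x else x0.

Lemma collapse_id (T : Type) (A : set T) (x0 x : T) :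
  A x -> collapse A x0 x = x.
Proof. by rewrite /collapse => Ax; case: asboolP. Qed.

Lemma collapse_out (T : Type) (A : set T) (x0 x : T) :
  ~ A x -> collapse A x0 x = x0.
Proof. by rewrite /collapse => Ax; case: asboolP. Qed.

(** An edge with exactly one end in [Y] has that end equal to [x0], so both of its ends go to
    [x0]. *)
Lemma collapse_continuous (T : Type) (X Y S : set T) (k : rel T) (x0 : T) :
  digital_image X k -> is_wedge X Y S k x0 ->
  digital_continuous X k Y k (collapse Y x0).
Proof.
move=> Xk wX; have [_ _ W'] := is_wedge_sym Xk wX.
case: wX => XE YS W.
have [Yx0 _] : (Y `&` S)%classic x0 by rewrite YS.
split=> [x _|x x' Xx Xx' xx'].
  by have [Yx|Yx] := pselect (Y x); [rewrite collapse_id|rewrite collapse_out].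
move: Xx Xx'; rewrite XE => Xx Xx'.
have [Yx|Yx] := pselect (Y x); have [Yx'|Yx'] := pselect (Y x').
- by rewrite !collapse_id //; right.
- case: Xx' => // Sx'; case: (W x x' Yx Sx') => [|<-|x0x']; first by right.
    by rewrite collapse_id // collapse_out //; left.
  by case: Yx'; rewrite -x0x'.
- case: Xx => // Sx; case: (W' x x' Sx Yx') => [|x0x|<-]; first by right.
    by case: Yx; rewrite -x0x.
  by rewrite collapse_out // collapse_id //; left.
- by rewrite !collapse_out //; left.
Qed.

Lemma digital_continuous_comp (T U V : Type) (X : set T) (Y : set U)
    (Z : set V) (k : rel T) (l : rel U) (p : rel V) (f : T -> U) (g : U -> V) :
  digital_continuous X k Y l f -> digital_continuous Y l Z p g ->
  digital_continuous X k Z p (g \o f).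
Proof.
move=> [fXY fk] [gYZ gl]; split=> [x Xx|x x' Xx Xx' /(fk _ _ Xx Xx')].
  exact/gYZ/fXY.
by move=> [/= ->|]; [left | apply: gl; exact: fXY].
Qed.

Lemma digital_continuous_subset (T U : Type) (X A : set T) (Y : set U)
    (k : rel T) (l : rel U) (f : T -> U) :
  (A `<=` X)%classic -> digital_continuous X k Y l f -> digital_continuous A k Y l f.
Proof.
move=> AX [fXY fk]; split=> [x /AX|x x' /AX Xx /AX Xx']; first exact: fXY.
exact: fk.
Qed.

Definition one_step (T : Type) (X : set T) (k : rel T) (g : T -> T) : Prop :=
  digital_continuous X k X k g /\ (forall x, X x -> g x = x \/ k (g x) x).

Lemma one_step_collapse (T : Type) (X Y S : set T) (k : rel T) (x0 : T)
    (g : T -> T) :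
  digital_image X k -> is_wedge X Y S k x0 -> one_step X k g ->
  one_step Y k (collapse Y x0 \o g).
Proof.
move=> Xk wX [gc g1]; have rc := collapse_continuous Xk wX.
have YX : (Y `<=` X)%classic by case: wX => -> _ _; exact: subsetUl.
split.
  exact: digital_continuous_subset YX (digital_continuous_comp gc rc).
move=> y Yy /=; have Xy := YX _ Yy; have Xgy := gc.1 _ Xy.
rewrite -[X in _ = X \/ k _ X](collapse_id x0 Yy).
by case: (g1 _ Xy) => [->|/(rc.2 _ _ Xgy Xy)]; [left|].
Qed.

Lemma one_step_homotopic (T : Type) (X : set T) (k : rel T) (g : T -> T) :
  digital_image X k -> one_step X k g -> homotopic X k X k g id.
Proof.
move=> [ksym kirr] [gc g1].
have idc : digital_continuous X k X k id by split=> // x x' _ _ ?; right.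
split=> //; exists 1, (fun x (t : int) => if t == 0 then g x else x).
split=> // [x Xx|t _]; last by case: eqP.
split=> [t _|t t' _ _ _] /=; first by case: eqP => // _; exact: gc.1.
case: eqP => _; case: eqP => _; [by left|exact: g1| |by left].
case: (g1 _ Xx) => [->|]; [by left|right; apply: ksym => //; exact: gc.1].
Qed.

Lemma rigid_of_one_step (T : Type) (X : set T) (k : rel T) :
  (forall g, one_step X k g -> forall x, X x -> g x = x) -> rigid X k.
Proof.
move=> fix1 f [_ _ [m [F [m0 Fend Ft Fx]]]] x Xx.
(* Here [j] counts the time steps back from the end, where [F] is the identity. *)
suff back (j : nat) : j%:Z <= m -> forall y, X y -> F y (m - j%:Z) = y.
  have [<- _] := Fend x Xx.
  have -> : 0 = m - `|m|%N%:Z by lia.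
  by apply: back => //; lia.
elim: j => [|j IH] jm y Xy.
  by have [_] := Fend y Xy; rewrite GRing.subr0.
pose t := m - j.+1%:Z.
have tI : interval_Z 0 m t by rewrite /interval_Z /= /t; lia.
have tI' : interval_Z 0 m (m - j%:Z) by rewrite /interval_Z /=; lia.
apply: (fix1 (F^~ t)) => //; split=> [|z Xz]; first exact: Fx.
have jm' : j%:Z <= m by lia.
(* By [IH] the point [z] is [F z (t + 1)], so continuity of [F] in time bounds the displacement of
   [z] at time [t]. *)
rewrite -[X in _ = X \/ k _ X](IH jm' z Xz).
by apply: (Ft z Xz).2 => //; rewrite /adj_Z /t; lia.
Qed.

(** Unrolling the cycle to a periodic sequence on [nat] allows induction along it without wrapping
    around. *)
Lemma simple_closed_curve_nat (T : Type) (S : set T) (k : rel T) (m : nat) :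
  (0 < m)%N -> simple_closed_curve S k m ->
  exists c : nat -> T,
    [/\ S = range c,
        forall i j, c i = c j <-> i = j %[mod m] &
        forall i j, k (c i) (c j) <-> i.+1 = j %[mod m] \/ i = j.+1 %[mod m]].
Proof.
move=> m0 [s [sI SE sk]].
pose o i : 'I_m := Ordinal (ltn_pmod i m0).
have oE (i : 'I_m) : o i = i by apply: val_inj; rewrite /= modn_small.
have oI i j : s (o i) = s (o j) <-> i = j %[mod m].
  by split=> [/sI/(congr1 val)|ij] //; congr s; exact: val_inj.
have oS i : ordS (o i) = o i.+1.
  by apply: val_inj; rewrite /= -addn1 modnDml addn1.
exists (s \o o); split=> [|//|i j].
  rewrite SE; apply/seteqP; split=> _ [i _ <-]; last by exists (o i).
  by exists (val i) => //=; rewrite oE.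
have Sj : S (s (o j)) by rewrite SE; exists (o j).
have predE : s (o j) = s (ord_pred (o i)) <-> i = j.+1 %[mod m].
  rewrite -oI -oS; split=> [/sI ->|/sI ->]; first by rewrite ord_predK.
  by rewrite ordSK.
have succE : s (o j) = s (ordS (o i)) <-> i.+1 = j %[mod m].
  by rewrite oS oI; split=> /esym.
by rewrite /= (sk _ _ Sj) predE succE; apply: or_comm.
Qed.

Lemma simple_closed_curve_one_step_id (T : Type) (S : set T) (k : rel T)
    (m : nat) (h : T -> T) (x0 : T) :
  (5 <= m)%N -> simple_closed_curve S k m -> one_step S k h ->
  S x0 -> h x0 = x0 -> forall x, S x -> h x = x.
Proof.
move=> m5 /simple_closed_curve_nat[|c [SE cI ck]]; first lia.
move=> [[hS hk] h1] Sx0 hx0.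
have Sc i : S (c i) by rewrite SE; exists i.
have modD i a b : i + a = i + b %[mod m] -> a = b %[mod m].
  by move/eqP; rewrite eqn_modDl => /eqP.
(* Equality or adjacency would make [d], [d - 1] or [d + 1] vanish modulo [m]. All three lie between
   1 and 4; the value 4, reached for [d = 3], is what calls for [5 <= m]. *)
have far i d : (d == 2) || (d == 3) ->
    ~ (c i = c (i + d)%N \/ k (c i) (c (i + d)%N)).
  move=> d23; rewrite cI ck; have F a b : (a < 5)%N -> (b < 5)%N ->
      a != b -> i + a <> i + b %[mod m].
    by move=> a5 b5 ab /modD; rewrite !modn_small; lia.
  case=> [|[|]].
  - by rewrite -{1}[i]addn0; apply: F; lia.
  - by rewrite -addn1; apply: F; lia.
  - by rewrite -addnS -{1}[i]addn0; apply: F; lia.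
(* The moved point has index [i.+1] so that its predecessor is [c i], with no subtraction on
   [nat]. *)
have step i : [\/ h (c i.+1) = c i, h (c i.+1) = c i.+1
                | h (c i.+1) = c i.+2].
  case: (h1 _ (Sc i.+1)) => [|]; first by constructor 2.
  have : S (h (c i.+1)) by exact: hS.
  rewrite {1}SE => -[j _ <-] /ck[|] ji; [constructor 1|constructor 3];
    apply/cI => //.
  by apply/eqP; rewrite -(eqn_modDr 1) !addn1; apply/eqP.
have near i : h (c i.+1) = h (c i.+2) \/ k (h (c i.+1)) (h (c i.+2)).
  by apply: hk => //; apply/ck; left.
(* U i says e_(i+1) <= 0 and D i says e_(i+1) >= 0. *)
pose U i := h (c i.+1) = c i \/ h (c i.+1) = c i.+1.
pose D i := h (c i.+1) = c i.+1 \/ h (c i.+1) = c i.+2.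
(* If [c i.+2] moved forward while [c i.+1] did not, their images would be 2 or 3 apart on the
   cycle, against [far]. [DS] is the mirror image. *)
have US i : U i -> U i.+1.
  move=> Ui; case: (step i.+1) => e; [by left|by right|].
  have := near i; rewrite e => n; case: Ui => e'; rewrite e' in n.
    by case: (@far i 3) => //; rewrite addn3.
  by case: (@far i.+1 2) => //; rewrite addn2.
have DS i : D i.+1 -> D i.
  move=> Di; case: (step i) => e; [|by left|by right].
  have := near i; rewrite e => n; case: Di => e'; rewrite e' in n.
    by case: (@far i 2) => //; rewrite addn2.
  by case: (@far i 3) => //; rewrite addn3.
have UD j i : U i -> U (i + j)%N.
  by elim: j => [|j IH] Ui; rewrite ?addn0 // addnS; exact/US/IH.
have DD j i : D (i + j)%N -> D i.
  by elim: j => [|j IH]; rewrite ?addn0 // addnS => /DS.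
have per i q : c (q * m + i)%N = c i by apply/cI; rewrite modnMDl.
(* Adding a full period makes the index of [x0] positive, hence a successor. *)
have [p cp] : exists p, c p.+1 = x0.
  move: Sx0; rewrite SE => -[p _ <-]; exists (m + p).-1.
  by rewrite prednK ?addn_gt0 //; [rewrite -[m]mul1n per|lia].
have Up : U p by right; rewrite cp.
have Dp q : D (q * m + p)%N by left; rewrite -addnS per cp.
(* [U] spreads only forward from [p], so the target is [p * m + i], which is at least [p] and
   congruent to [i]. For [D], which spreads backward, the start is raised to [i * m + p] instead. *)
have Ui i : U i.
  have := UD (p * m + i - p)%N p Up; rewrite subnKC; last by nia.
  by rewrite /U -!addnS !per.
have Di i : D i.
  apply: (DD (i * m + p - i)%N); rewrite subnKC; last by nia.
  exact: Dp.
have fixS i : h (c i.+1) = c i.+1.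
  case: (Ui i) => // e; case: (Di i) => // e'.
  by case: (@far i 2) => //; left; rewrite addn2 -e.
move=> x; rewrite SE => -[i _ <-].
have -> : c i = c ((1 * m + i).-1.+1) by rewrite prednK ?per //; lia.
exact: fixS.
Qed.

Lemma wedge_one_step_id (T : Type) (X Y S : set T) (k : rel T) (x0 : T)
    (m : nat) (g : T -> T) :
  digital_image X k -> is_wedge X Y S k x0 ->
  (exists2 y, Y y & k y x0) -> rigid Y k ->
  (5 <= m)%N -> simple_closed_curve S k m ->
  one_step X k g -> forall x, X x -> g x = x.
Proof.
move=> Xk wX [y1 Yy1 y1x0] Yrigid m5 Sm g1.
have wX' := is_wedge_sym Xk wX.
have gY1 := one_step_collapse Xk wX g1.
have gS1 := one_step_collapse Xk wX' g1.
case: g1 => [[gX gk] _]; case: wX => XE YS W.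
have [Yx0 Sx0] : (Y `&` S)%classic x0 by rewrite YS.
have Yk : digital_image Y k.
  case: Xk => ksym kirr.
  by split=> [x y Yx Yy|x Yx]; [apply: ksym|apply: kirr]; rewrite XE; left.
have Xk2 := Xk.2; have YX y : Y y -> X y by rewrite XE; left.
have SX s : S s -> X s by rewrite XE; right.
have rg := Yrigid _ (one_step_homotopic Yk gY1).
(* Were [g y] outside [Y], its collapse would be [x0], whereas rigidity makes it [y]. *)
have gY y : Y y -> y <> x0 -> g y = y.
  move=> Yy yx0; have /= := rg y Yy.
  have [Yg|Yg] := pselect (Y (g y)); first by rewrite collapse_id.
  by rewrite collapse_out // => /esym.
(* Rigidity alone does not stop [g] from pushing [x0] into [S]. But [g x0] is equal or adjacent to
   [g y1 = y1], a point of [Y] other than [x0], and the only point of [S] with that property is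
   [x0]. *)
have gx0 : g x0 = x0.
  have y1N : y1 <> x0.
    by move=> e; move: y1x0; rewrite e; apply/negP/Xk2/YX.
  have /= := rg x0 Yx0.
  have [Yg|Yg _] := pselect (Y (g x0)); first by rewrite collapse_id.
  have Sg : S (g x0) by have := gX _ (YX _ Yx0); rewrite XE => -[].
  have := gk _ _ (YX _ Yy1) (YX _ Yx0) y1x0; rewrite (gY _ Yy1 y1N).
  by move=> /(W _ _ Yy1 Sg)[/esym|/esym].
have hS : forall s, S s -> collapse S x0 (g s) = s.
  apply: (simple_closed_curve_one_step_id m5 Sm gS1 Sx0).
  by rewrite /= gx0 collapse_id.
move=> x; rewrite {1}XE => Xx.
have [->//|xx0] := pselect (x = x0).
case: Xx => [/gY->//|Sx]; have := hS x Sx.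
have [Sg|Sg] := pselect (S (g x)); first by rewrite collapse_id.
by rewrite collapse_out // => /esym.
Qed.

(* [hx0] says that x0 is not isolated in Y; it follows from 1 < #Y when Y is
   connected. If x0 is isolated in Y then rotating S by one step and fixing
   the rest of X is homotopic to the identity, so X is never rigid. *)
Theorem theorem4p6 (n : nat) (k : rel 'rV[int]_n) (X Y S : set 'rV[int]_n)
    (x0 : 'rV[int]_n) (m : nat)
    (hk : digital_image X k)
    (hX : is_wedge X Y S k x0)
    (hYfin : finite_set Y)
    (hY1 : (1 < #|` fset_set Y|)%N)
    (hx0 : exists2 y, Y y & k y x0)
    (hYrigid : rigid Y k)
    (hm : (5 <= m)%N)
    (hS : simple_closed_curve S k m) :
  rigid X k.
Proof.
apply: rigid_of_one_step => g.
exact: (wedge_one_step_id hk hX hx0 hYrigid hm hS).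
Qed.
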